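(* Let $\mathcal N$ be a Hilbert space and let $\mathcal M$ be a reproducing kernel Hilbert space of $\mathcal N$-valued DA functions on $\Lambda$ such that $A=Z_-\in\mathbf L(\mathcal M)$ (i.e. $\mathcal M$ is $Z_-$-invariant and $Z_-$ restricts to a bounded operator $A$ on $\mathcal M$) and $\mathbf S(\Lambda)\cap\sigma(A)=\emptyset$. Then, for every $f\in\mathcal M$ and every $z\in\mathbf V(\Lambda)$ the following point evaluation formula holds: $$C(I-zA)^{-\odot}f=f(z),$$ where $C\in\mathbf L(\mathcal M,\mathcal N)$ is given by $Cf=f(0)$. In particular, the reproducing kernel $K(z,w)$ of $\mathcal M$ is of the form $K(z,w)=F(z)F(w)^*$ with $F(z)=C(I-zA)^{-\odot}$.
   Context: Rhombic lattice: $\Lambda$ is a monohedral (edge-to-edge) tessellation of $\mathbb C$ by mutually congruent (nondegenerate) rhombi of side length 1, viewed as a planar graph with vertex set $\mathbf V(\Lambda)$, (undirected) edge set $\mathbf E(\Lambda)$ and face set $\mathbf F(\Lambda)$ (the rhombi). $\hat{\mathbf E}(\Lambda)=\{b-a:(a,b)\in\mathbf E(\Lambda)\}$ is the set of edge directions; it is finite and closed under $e\mapsto -e$. A path from $a$ to $b$ is a finite sequence $(z_0=a,z_1,\dots,z_N=b)$ of vertices with consecutive ones adjacent; it is closed if $a=b$. Standing assumptions: $0\in\mathbf V(\Lambda)$; $1\in\hat{\mathbf E}(\Lambda)$; and both sides of every track $F$ in $\Lambda$ contain tracks that are coherent to $F$. Here a track is a sequence $(F_n)_{n\in\mathbb Z}$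 of faces such that for every $n$ the faces $F_n,F_{n+1}$ are adjacent and the edges shared by $F_n$ with $F_{n+1}$ and with $F_{n-1}$ are two opposite sides of $F_n$; these shared edges are the ties of the track. The sides of a track are the two connected components of the graph obtained by deleting all ties of the track from $\mathbf E(\Lambda)$. Two tracks are coherent if their ties are parallel. DA functions: for $f:\mathbf V(\Lambda)\to\mathcal V$ ($\mathcal V$ a complex vector space) and a path $\gamma=(z_0,\dots,z_N)$, $\int_\gamma f\,\delta z=\sum_{n=1}^N\frac{f(z_{n-1})+f(z_n)}{2}(z_n-z_{n-1})$. $f$ is discrete analytic (DA) if $\int_\gamma f\,\delta z=0$ for every closed path $\gamma$; $\int_a^b f\,\delta z$ denotes the then path-independent integral along any path from $a$ to $b$. $\mathcal H(\Lambda)$ is the space of ($\mathcal V$-valued) DA functions. Shifts: $(Z_+f)(z)=\frac{f(0)-f(z)}{2}+\int_0^z f\,\delta z$ maps $\mathcal H(\Lambda)$ to itself, and is injective with range $\{f\in\mathcal H(\Lambda):f(0)=0\}$. $Z_-g$ is the unique element of $\mathcal H(\Lambda)$ with $(Z_+Z_-g)(z)=g(z)-g(0)$. Notation: $\mathbf L(\mathcal M,\mathcal N)$ is the space of bounded linear operators, $\mathbf L(\mathcal M)=\mathbf L(\mathcal M,\mathcal M)$; $\mathbf S(\Lambda)=\{t\in\mathbb C:2+t(1-e)=0\text{ for some }e\in\hat{\mathbf E}(\Lambda)\}$. For $A\in\mathbf L(\mathcal M)$ with $\sigma(A)\cap\mathbf S(\Lambda)=\emptyset$, $(I-zA)^{-\odot}$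 is the $\mathbf L(\mathcal M)$-valued DA function $G$ satisfying $G-(Z_+G)A=G-A(Z_+G)=I$, given by $G(z)=\prod_{k=1}^N\big((2I+(1+z_k-z_{k-1})A)(2I+(1+z_{k-1}-z_k)A)^{-1}\big)$ for any path $(z_0,\dots,z_N)$ from $0$ to $z$. *)

(* Defs.v *)
From HB Require Import structures.
From mathcomp Require Import all_boot all_order all_algebra.
From mathcomp Require Import complex.
From mathcomp Require Import all_classical all_reals all_analysis.

Set Implicit Arguments.
Unset Strict Implicit.
Unset Printing Implicit Defensive.

Import Order.TTheory GRing.Theory Num.Theory.
Import numFieldNormedType.Exports.

Local Open Scope classical_set_scope.
Local Open Scope complex_scope.
Local Open Scope ring_scope.

Section Rhombi.
Variable R : realType.
Local Notation C := R[i].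
Implicit Types (a b u v z w : C) (P Q : set C).

Definition segment a b : set C :=
  [set z | exists2 t : R, 0 <= t <= 1 & z = a + t%:C * (b - a)].

Definition rhombus a u v : set C :=
  [set z | exists s t : R,
     [/\ 0 <= s <= 1, 0 <= t <= 1 & z = a + s%:C * u + t%:C * v]].

(* [P] is the nondegenerate rhombus with side length 1 that has a corner at [a]
   and whose sides from [a] go in the directions [u] and [v]. *)
Definition rhombus_at P a u v : Prop :=
  [/\ `|u| = 1, `|v| = 1, v != u, v != - u & P = rhombus a u v].

(* Every corner of a rhombus can serve as the base point of such a
   description, which is why these cover all four corners and all sides. *)
Definition corner P a : Prop := exists u v, rhombus_at P a u v.

Definition side P a b : Prop := exists v, rhombus_at P a (b - a) v.

Definition congruent P Q : Prop :=
  exists phi : C -> C,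
    [/\ bijective phi, forall x y, `|phi x - phi y| = `|x - y|
      & phi @` P = Q].

Record rhombic_tessellation (F : set (set C)) : Prop := RhombicTessellation {
  tess_rhombus : forall P, F P -> exists a u v, rhombus_at P a u v ;
  tess_congruent : forall P Q, F P -> F Q -> congruent P Q ;
  tess_cover : forall z, exists2 P, F P & P z ;
  tess_edge_to_edge : forall P Q, F P -> F Q -> P <> Q ->
    [\/ P `&` Q = set0,
        exists a, [/\ corner P a, corner Q a & P `&` Q = [set a]]
      | exists a b, [/\ side P a b, side Q a b & P `&` Q = segment a b]]
}.

End Rhombi.

Record rhombicLattice (R : realType) := RhombicLattice {
  faces :> set (set R[i]) ;
  facesP : rhombic_tessellation faces
}.

Section Lattice.
Variables (R : realType) (Lam : rhombicLattice R).
Local Notation C := R[i].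

Definition vertices : set C := [set z | exists2 P, faces Lam P & corner P z].

Definition vertex : Type := set_type vertices.

Definition edge (a b : C) : Prop := exists2 P, faces Lam P & side P a b.

Definition directions : set C := [set e | exists a b, edge a b /\ e = b - a].

Definition adjacent : rel vertex := fun x y => `[< edge (val x) (val y) >].

(* The path (z_0, ..., z_N) is represented by its initial point [a] = z_0 and
   the sequence [p] = (z_1, ..., z_N). *)
Definition lpath (a b : vertex) (p : seq vertex) : Prop :=
  path adjacent a p /\ last a p = b.

Definition shared_side (P Q : set C) (a b : C) : Prop :=
  [/\ P <> Q, side P a b & side Q a b].

Definition track (T : int -> set C) : Prop :=
  forall n : int, faces Lam (T n) /\
    exists a u v, [/\ rhombus_at (T n) a u v,
      shared_side (T n) (T (n - 1)) a (a + u)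
    & shared_side (T n) (T (n + 1)) (a + v) (a + v + u)].

Definition tie (T : int -> set C) (a b : C) : Prop :=
  exists n : int, shared_side (T n) (T (n + 1)) a b.

Definition coherent (T T' : int -> set C) : Prop :=
  forall a b c d, tie T a b -> tie T' c d -> exists k : R, d - c = k%:C * (b - a).

Definition nontie_adjacent (T : int -> set C) : rel vertex :=
  fun x y => adjacent x y && ~~ `[< tie T (val x) (val y) >].

(* The vertex sets of the connected components that remain when the ties are
   deleted. *)
Definition track_side (T : int -> set C) (S : set vertex) : Prop :=
  exists x, S = [set y | exists2 p, path (nontie_adjacent T) x p & last x p = y].

Definition coherent_tracks_on_both_sides : Prop :=
  forall T S, track T -> track_side T S ->
  exists T', [/\ track T', coherent T T'
    & forall n (z : vertex), corner (T' n) (val z) -> S z].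

Section Integral.
Variable V : lmodType C.
Implicit Type f : vertex -> V.

Fixpoint path_integral f (a : vertex) (p : seq vertex) : V :=
  if p is b :: p' then
    (val b - val a) *: (2^-1 *: (f a + f b)) + path_integral f b p'
  else 0.

Definition discrete_analytic f : Prop :=
  forall a p, lpath a a p -> path_integral f a p = 0.

(* The integral along some path from [a] to [b]; when [f] is discrete analytic
   it does not depend on the path. *)
Definition integral f (a b : vertex) : V :=
  path_integral f a (xget [::] [set p | lpath a b p]).

(* The shift operators; the vertex [o] is meant to be the origin. *)
Definition Zplus (o : vertex) f (z : vertex) : V :=
  2^-1 *: (f o - f z) + integral f o z.

(* The graph of the operator Z_-, that is g = Z_- f. As Z_+ is injective on the
   discrete analytic functions, there is at most one such g. *)
Definition is_Zminus (o : vertex) f (g : vertex -> V) : Prop :=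
  discrete_analytic g /\ forall z, Zplus o g z = f z - f o.

End Integral.

Definition singular_set : set C :=
  [set t | exists2 e, directions e & 2 + t * (1 - e) = 0].

End Lattice.

Section Operators.
Variable R : realType.
Local Notation C := R[i].

Definition bounded_operator (M N : normedModType C) (T : M -> N) : Prop :=
  linear T /\ exists k : C, forall x, `|T x| <= k * `|x|.

Definition spectrum (M : normedModType C) (A : M -> M) : set C :=
  [set t | ~ exists B : M -> M, [/\ bounded_operator B,
      B \o (t *: id - A) = id & (t *: id - A) \o B = id]].

(* A complete normed space together with such an [ip] is a Hilbert space; [ip]
   is linear in its first argument and conjugate linear in its second. *)
Definition hilbert_product (M : completeNormedModType C)
    (ip : {dot M for @Num.conj C}) : Prop :=
  forall x, ip x x = `|x| ^+ 2.

Definition adjoint (M N : completeNormedModType C)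
    (ipM : {dot M for @Num.conj C}) (ipN : {dot N for @Num.conj C})
    (T : M -> N) : N -> M :=
  xget (fun=> 0) [set S | forall x y, ipN (T x) y = ipM x (S y)].

Variable Lam : rhombicLattice R.

(* [G] is the function z |-> (I - zA)^{-\odot} *)
Definition is_symbolic_resolvent (M : normedModType C) (o : vertex Lam)
    (A : M -> M) (G : vertex Lam -> (M -> M)) : Prop :=
  [/\ forall z, bounded_operator (G z), discrete_analytic G,
      forall z, G z - (Zplus o G z \o A) = id
    & forall z, G z - (A \o Zplus o G z) = id].

(* (I - zA)^{-\odot}; the conditions above determine it uniquely when the
   spectrum of [A] does not meet the singular set of the lattice. *)
Definition symbolic_resolvent (M : normedModType C) (o : vertex Lam)
    (A : M -> M) : vertex Lam -> (M -> M) :=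
  xget (fun _ _ => 0) [set G | is_symbolic_resolvent o A G].

Section RKHS.
Variables M N : completeNormedModType C.

(* The elements of [M] are identified with functions by [ev]: [ev f z] is the
   value of [f] at the vertex [z]. *)
Definition rkhs_of_da_functions (ev : M -> vertex Lam -> N) : Prop :=
  [/\ linear ev, injective ev, forall f, discrete_analytic (ev f)
    & forall z, bounded_operator (fun f => ev f z)].

Definition reproducing_kernel (ipM : {dot M for @Num.conj C})
    (ipN : {dot N for @Num.conj C}) (ev : M -> vertex Lam -> N)
    (K : vertex Lam -> vertex Lam -> (N -> N)) : Prop :=
  (forall z w, bounded_operator (K z w)) /\
  forall w x, exists2 k : M, forall z, ev k z = K z w x
                           & forall f, ipM f k = ipN (ev f w) x.

End RKHS.
End Operators.

(* Main.v *)
(* Write e = w - z for an edge from z to w.  Unfolding Z_+ along the edge turns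
   f - f(0) = Z_+ (A f) into
     ev_w (2 + (1 - e) A) = ev_z (2 + (1 + e) A),
   where ev_z is the evaluation at z, so since 2 + (1 - e) A is invertible each
   ev_z has the form ev_0 G(z) with G(z) in the bicommutant of A.  No homotopy
   argument is needed to see that such a G is the symbolic resolvent: operators
   S, T that commute with all G(w) and satisfy ev_0 S = ev_0 T also satisfy
   ev_w S = ev_0 G(w) S = ev_w T for all w and are therefore equal, which reduces
   every identity for G to the corresponding identity for the functions in M.
   Conversely, every symbolic resolvent obeys the same recursion along edges.
   This needs paths from 0 to all vertices.  The congruent rhombi have a common
   inradius, so they are locally finite, and whether a point lies in a rhombus
   linked to 0 is a locally constant property. *)
Require Import Defs.
From HB Require Import structures.
From mathcomp Require Import all_boot all_order all_algebra.
From mathcomp Require Import complex.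
From mathcomp Require Import ring lra.
From mathcomp Require Import all_classical all_reals all_analysis.
Import Order.TTheory GRing.Theory Num.Theory.
Import numFieldNormedType.Exports.
Local Open Scope classical_set_scope.
Local Open Scope complex_scope.
Local Open Scope ring_scope.
Local Notation Re := (@complex.Re _).
Local Notation Im := (@complex.Im _).

(** * Rhombi *)

Section PlaneGeometry.
Context {R : realType}.
Local Notation C := R[i].
Implicit Types (a b c u v w x y z : C) (P Q : set C).

Lemma normc_lt_sqr z (r : R) : 0 <= r ->
  (`|z| < r%:C) = (Re z ^+ 2 + Im z ^+ 2 < r ^+ 2).
Proof.
move=> r0; rewrite -(ltr_sqr (x := `|z|)) ?nnegrE ?normr_ge0 ?ler0c //.
by rewrite -add_Re2_Im2 -rmorphXn ltcR.
Qed.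

Lemma normc1_sqr z : `|z| = 1 -> Re z ^+ 2 + Im z ^+ 2 = 1.
Proof. by move=> z1; apply: complexI; rewrite add_Re2_Im2 z1 expr1n. Qed.

Lemma normc_ge_Re z : (`|Re z|)%:C <= `|z|.
Proof.
rewrite normc_def lecR -sqrtr_sqr ler_sqrt ?lerDl ?sqr_ge0 //.
by rewrite addr_ge0 ?sqr_ge0.
Qed.

Lemma normc_ge_Im z : (`|Im z|)%:C <= `|z|.
Proof.
rewrite normc_def lecR -sqrtr_sqr ler_sqrt ?lerDr ?sqr_ge0 //.
by rewrite addr_ge0 ?sqr_ge0.
Qed.

Definition cross u v : R := Re u * Im v - Im u * Re v.

Lemma cross_neq0 u v :
  `|u| = 1 -> `|v| = 1 -> v != u -> v != - u -> cross u v != 0.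
Proof.
move=> /normc1_sqr + /normc1_sqr; rewrite /cross !eq_complex.
case: u v => [u1 u2] [v1 v2] /= u1' v1'.
rewrite !negb_and => vu vNu; apply/eqP => uv0.
(* For unit vectors the difference of the squared first coordinates is (u1 v2 - u2 v1) (u1 v2 + u2
   v1). So [v] agrees with [u] up to the signs of the coordinates, and mixed signs force a
   coordinate to vanish. *)
have e1 : (v1 - u1) * (v1 + u1) = 0.
  have : u1 ^+ 2 - v1 ^+ 2 =
      u1 ^+ 2 * (v1 ^+ 2 + v2 ^+ 2) - v1 ^+ 2 * (u1 ^+ 2 + u2 ^+ 2).
    by rewrite u1' v1' !mulr1.
  have -> : u1 ^+ 2 * (v1 ^+ 2 + v2 ^+ 2) - v1 ^+ 2 * (u1 ^+ 2 + u2 ^+ 2) =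
      (u1 * v2 - u2 * v1) * (u1 * v2 + u2 * v1) by ring.
  rewrite uv0 mul0r => e; rewrite -[RHS]oppr0 -e; ring.
have e2 : (v2 - u2) * (v2 + u2) = 0 by move: e1; nra.
move/eqP: e1; rewrite mulf_eq0; move/eqP: e2; rewrite mulf_eq0.
rewrite !subr_eq0 !addr_eq0.
case/orP=> /eqP e2; case/orP=> /eqP e1; move: vu vNu uv0 u1';
  rewrite e1 e2 ?eqxx //=.
- rewrite ?orbF ?eqrNxx ?eqNr => *; nra.
- nra.
Qed.

Lemma coordinates u v y : cross u v != 0 ->
  exists s t : R, y = s%:C * u + t%:C * v.
Proof.
move=> uv; exists (cross y v / cross u v), (cross u y / cross u v).
move: uv; rewrite /cross; case: u v y => [u1 u2] [v1 v2] [y1 y2] /= uv.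
by simpc; apply/eqP; rewrite eq_complex /=; apply/andP; split; apply/eqP; field.
Qed.

(** Cramer's rule gives s cross(u, v) = cross(y, v), and since |v| = 1, Lagrange's identity splits
    |y|^2 into cross(y, v)^2 and the square of an inner product; likewise for [t]. *)
Lemma coordinates_le u v (s t : R) (y := s%:C * u + t%:C * v) :
  `|u| = 1 -> `|v| = 1 ->
  (s * cross u v) ^+ 2 <= Re y ^+ 2 + Im y ^+ 2 /\
  (t * cross u v) ^+ 2 <= Re y ^+ 2 + Im y ^+ 2.
Proof.
rewrite /y => /normc1_sqr + /normc1_sqr; rewrite /cross.
case: u v {y} => [u1 u2] [v1 v2] /= u1' v1'; simpc => /=.
set a := s * u1 + t * v1; set b := s * u2 + t * v2.
split.
- have -> : a ^+ 2 + b ^+ 2 =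
      (s * (u1 * v2 - u2 * v1)) ^+ 2 + (a * v1 + b * v2) ^+ 2.
    by rewrite -[LHS]mulr1 -v1' /a /b; ring.
  by rewrite lerDl sqr_ge0.
- have -> : a ^+ 2 + b ^+ 2 =
      (t * (u1 * v2 - u2 * v1)) ^+ 2 + (a * u1 + b * u2) ^+ 2.
    by rewrite -[LHS]mulr1 -u1' /a /b; ring.
  by rewrite lerDl sqr_ge0.
Qed.

Lemma coordinates_lt u v (s t r : R) : `|u| = 1 -> `|v| = 1 -> cross u v != 0 ->
  0 <= r -> `|s%:C * u + t%:C * v| < (`|cross u v| * r)%:C -> `|s| < r /\ `|t| < r.
Proof.
move=> u1 v1 uv r0; rewrite normc_lt_sqr ?mulr_ge0 // => yr.
have [hs ht] := coordinates_le u v s t u1 v1.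
have uv0 : 0 < `|cross u v| by rewrite normr_gt0.
split; rewrite -(ltr_pM2l uv0) -ltr_sqr ?nnegrE ?mulr_ge0 //.
- by apply: le_lt_trans yr; rewrite -normrM real_normK ?num_real // mulrC.
- by apply: le_lt_trans yr; rewrite -normrM real_normK ?num_real // mulrC.
Qed.

Lemma rhombus_ball P a u v : rhombus_at P a u v ->
  exists c (r : R), 0 < r /\ forall y, `|y - c| < r%:C -> P y.
Proof.
case=> u1 v1 vu vNu ->; have uv := cross_neq0 _ _ u1 v1 vu vNu.
(* The inscribed disc: opposite sides are |cross(u, v)| apart. *)
exists (a + (2^-1)%:C * u + (2^-1)%:C * v), (`|cross u v| * 2^-1).
split=> [|y]; first by rewrite mulr_gt0 ?normr_gt0 ?invr_gt0.
have [s [t e]] := coordinates _ _ (y - (a + (2^-1)%:C * u + (2^-1)%:C * v)) uv.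
rewrite e => /(coordinates_lt _ _ _ _ _ u1 v1 uv)[]; first by rewrite invr_ge0.
rewrite !ltr_norml => /andP[s1 s2] /andP[t1 t2].
exists (2^-1 + s), (2^-1 + t); split; [lra|lra|].
rewrite !rmorphD -[y](subrK (a + (2^-1)%:C * u + (2^-1)%:C * v)) e /=; ring.
Qed.

Lemma rhombus_separated P a u v x : rhombus_at P a u v -> ~ P x ->
  exists2 d : R, 0 < d & forall y, P y -> ~ `|y - x| < d%:C.
Proof.
case=> u1 v1 vu vNu ->; have uv := cross_neq0 _ _ u1 v1 vu vNu.
have uv0 : 0 < `|cross u v| by rewrite normr_gt0.
have [s [t e]] := coordinates _ _ (x - a) uv.
have {e}e : x = a + s%:C * u + t%:C * v by rewrite -addrA -e addrC subrK.
move=> Px.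
(* Some coordinate of [x] lies outside [0, 1], and [d] is the amount by which it does. *)
have [d d0 dP] : exists2 d : R, 0 < d & forall s' t', 0 <= s' <= 1 -> 0 <= t' <= 1 ->
    ~ (`|s' - s| < d /\ `|t' - t| < d).
  have [s0|s0] := ltP s 0.
    by exists (- s); [lra|move=> s' t' + + []; rewrite !ltr_norml; lra].
  have [s1|s1] := ltP 1 s.
    by exists (s - 1); [lra|move=> s' t' + + []; rewrite !ltr_norml; lra].
  have [t0|t0] := ltP t 0.
    by exists (- t); [lra|move=> s' t' + + []; rewrite !ltr_norml; lra].
  have [t1|t1] := ltP 1 t.
    by exists (t - 1); [lra|move=> s' t' + + []; rewrite !ltr_norml; lra].
  by case: Px; exists s, t; split=> //; apply/andP.
exists (`|cross u v| * d) => [|y [s' [t' [s01 t01 ->]]]]; first exact: mulr_gt0.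
have -> : a + s'%:C * u + t'%:C * v - x = (s' - s)%:C * u + (t' - t)%:C * v.
  by rewrite e !rmorphB /=; ring.
by move/(coordinates_lt _ _ _ _ _ u1 v1 uv (ltW d0)); apply: dP.
Qed.

Lemma rhombus_diameter P a u v y z : rhombus_at P a u v -> P y -> P z ->
  `|y - z| <= 2.
Proof.
case=> u1 v1 _ _ -> [s [t [s01 t01 ->]]] [s' [t' [s01' t01' ->]]].
have -> : a + s%:C * u + t%:C * v - (a + s'%:C * u + t'%:C * v) =
   (s - s')%:C * u + (t - t')%:C * v by rewrite !rmorphB /=; ring.
apply: le_trans (ler_normD _ _) _; rewrite !normrM u1 v1 !mulr1.
rewrite [2](_ : _ = 1%:C + 1%:C) //; apply: lerD;
  rewrite normc_def lecR /= expr0n addr0 sqrtr_sqr ler_norml; lra.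
Qed.

(** The centre and its translates by r/2 and i r/2 would lie on one line, making a real and an
    imaginary number both real multiples of [b - a]. *)
Lemma segment_no_ball a b c (r : R) : 0 < r ->
  ~ (forall y, `|y - c| < r%:C -> segment a b y).
Proof.
move=> r0 H.
have r20 : 0 < r / 2 by rewrite divr_gt0.
have [t0 _ e0] : segment a b c by apply: H; rewrite subrr normr0 ltcR.
have [t1 _ e1] : segment a b (c + (r / 2)%:C).
  apply: H; rewrite [_ - c]addrC addKr normc_lt_sqr ?ltW //= expr0n addr0; nra.
have [t2 _ e2] : segment a b (c + (r / 2)%:C * 'i%C).
  apply: H; rewrite [_ - c]addrC addKr normc_lt_sqr ?ltW //=; nra.
have : (r / 2)%:C = (t1 - t0)%:C * (b - a).
  rewrite rmorphB mulrBl /= -(addrK c (r / 2)%:C) [_ + c]addrC e1.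
  by rewrite [in LHS]e0 /=; ring.
have : (r / 2)%:C * 'i%C = (t2 - t0)%:C * (b - a).
  rewrite rmorphB mulrBl /= -(addrK c (_ * 'i%C)) [_ + c]addrC e2.
  by rewrite [in LHS]e0 /=; ring.
case: (b - a) => x y; simpc => -[i0 i1] [j0 j1].
clear H e0 e1 e2; have tx : (t1 - t0) * x != 0 by rewrite -j0 gt_eqF.
move: tx i1; rewrite mulf_eq0 negb_or => /andP[t10 _].
move/esym/eqP: j1; rewrite mulf_eq0 (negbTE t10) => /eqP ->.
by rewrite mulr0 => /eqP; rewrite gt_eqF.
Qed.

Lemma rhombus_swap P a u v : rhombus_at P a u v -> rhombus_at P a v u.
Proof.
case=> u1 v1 vu vNu ->; split=> //; first by rewrite eq_sym.
  by rewrite -eqr_oppLR eq_sym.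
apply/seteqP; split=> y [s [t [s01 t01 ->]]]; exists t, s; split=> //;
by rewrite addrAC.
Qed.

Lemma rhombus_turn P a u v : rhombus_at P a u v -> rhombus_at P (a + u) v (- u).
Proof.
case=> u1 v1 vu vNu ->; split=> //; rewrite ?normrN //.
- by rewrite eq_sym.
- by rewrite eqr_opp eq_sym.
apply/seteqP; split=> y [s [t [s01 t01 ->]]].
- exists t, (1 - s); split=> //; first by lra.
  by rewrite rmorphB rmorph1; ring.
- exists (1 - t), s; split=> //; first by lra.
  by rewrite rmorphB rmorph1; ring.
Qed.

Lemma corner_mem P a : corner P a -> P a.
Proof.
case=> u [v [_ _ _ _ ->]]; exists 0, 0.
by split; rewrite ?lexx ?ler01 // !mul0r !addr0.
Qed.

(** A corner is an extreme point: the coordinates of [d] and [- d] are nonnegative and add up to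
    zero. Extremality depends only on the set [P], not on its description by sides. *)
Lemma corner_extreme P a d : corner P a -> P (a + d) -> P (a - d) -> d = 0.
Proof.
case=> u [v [u1 v1 vu vNu ->]].
have uv := cross_neq0 _ _ u1 v1 vu vNu.
move=> [s [t [s01 t01 e]]] [s' [t' [s01' t01' e']]].
have d1 : d = s%:C * u + t%:C * v by apply: (addrI a); rewrite e addrA.
have d2 : - d = s'%:C * u + t'%:C * v by apply: (addrI a); rewrite e' addrA.
have := coordinates_le u v (s + s') (t + t') u1 v1.
have -> : (s + s')%:C * u + (t + t')%:C * v = 0.
  by rewrite -(subrr d) {1}d1 d2 !rmorphD /=; ring.
have z0 (x : R) :
    (x * cross u v) ^+ 2 <= Re (0 : C) ^+ 2 + Im (0 : C) ^+ 2 -> x = 0.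
  rewrite /= expr0n addr0 /= => h; apply/eqP.
  have : (x * cross u v) ^+ 2 == 0 by rewrite eq_le h sqr_ge0.
  by rewrite sqrf_eq0 mulf_eq0 (negbTE uv) orbF.
case=> /z0 h1 /z0 h2.
rewrite d1; have -> : s = 0 by lra.
have -> : t = 0 by lra.
by rewrite !mul0r addr0.
Qed.

Lemma corner_ends a u v (s t : R) : `|u| = 1 -> 0 <= s <= 1 -> 0 <= t <= 1 ->
  corner (rhombus a u v) (a + s%:C * u + t%:C * v) -> s = 0 \/ s = 1.
Proof.
move=> u1 s01 t01 cb.
have [->|s0] := eqVneq s 0; [by left|have [->|s1] := eqVneq s 1; [by right|]].
have {}s0 : 0 < s by rewrite lt0r s0; lra.
have {}s1 : s < 1 by rewrite lt_neqAle s1; lra.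
(* For [s] strictly between 0 and 1, the point could be moved by [e] both ways along [u] inside the
   rhombus. *)
pose e := Num.min s (1 - s).
have e0 : 0 < e by rewrite lt_min s0 subr_gt0.
have e1 : e <= s by rewrite ge_min lexx.
have e2 : e <= 1 - s by rewrite ge_min lexx orbT.
have : e%:C * u = 0.
  apply: (corner_extreme _ _ _ cb).
  - by exists (s + e), t; split=> //; [lra|rewrite rmorphD /=; ring].
  - by exists (s - e), t; split=> //; [lra|rewrite rmorphB /=; ring].
move/eqP; rewrite mulf_eq0 -[u == 0]normr_eq0 u1 oner_eq0 orbF.
by move/eqP => [] e00; rewrite e00 ltxx in e0.
Qed.

(** [corner] admits any description of the set [P]; extremality excludes base points other than the
    four visible in the given description. *)
Lemma corner_cases P a u v b : rhombus_at P a u v -> corner P b ->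
  [\/ b = a, b = a + u, b = a + v | b = a + u + v].
Proof.
move=> Puv cb; have := corner_mem _ _ cb.
have [v1 _ _ _ Pvu] := rhombus_swap _ _ _ _ Puv.
case: Puv => u1 _ _ _ eP; rewrite {1}eP => -[s [t [s01 t01 eb]]].
have hs : s = 0 \/ s = 1.
  by apply: (corner_ends a u v s t) => //; rewrite -eP -eb.
have ht : t = 0 \/ t = 1.
  by apply: (corner_ends a v u t s) => //; rewrite -Pvu addrAC -eb.
rewrite eb; case: hs => ->; case: ht => ->; rewrite ?mul0r ?mul1r ?addr0.
- by constructor 1.
- by constructor 3.
- by constructor 2.
- by constructor 4.
Qed.

End PlaneGeometry.

(** * Connectivity of the lattice *)

Section Connectivity.
Context {R : realType} (Lam : rhombicLattice R).
Local Notation C := R[i].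
Implicit Types (x y z : vertex Lam) (P Q : set C).

Definition linked x y : Prop := exists p, lpath x y p.

Lemma linked_trans x y z : linked x y -> linked y z -> linked x z.
Proof.
move=> [p [xp <-]] [q [yq <-]]; exists (p ++ q); split; last by rewrite last_cat.
by rewrite cat_path xp.
Qed.

Lemma adjacent_linked x y : edge Lam (val x) (val y) -> linked x y.
Proof. by move=> xy; exists [:: y]; split=> //=; rewrite andbT; apply/asboolP. Qed.

Lemma corner_vertex P (a : C) : faces Lam P -> corner P a ->
  exists x : vertex Lam, val x = a.
Proof.
move=> FP Pa; have va : vertices Lam a by exists P.
by exists (SigSub (mem_set va)).
Qed.

Lemma face_linked P x y : faces Lam P -> corner P (val x) -> corner P (val y) ->
  linked x y.
Proof.
move=> FP [u [v Puv]] cy.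
have Pvu := rhombus_swap _ _ _ _ Puv.
have Pt := rhombus_turn _ _ _ _ Puv.
case: (corner_cases _ _ _ _ _ Puv cy) => ey.
- by exists [::]; split=> //; apply: val_inj.
- by apply: adjacent_linked; exists P => //; exists v; rewrite ey addrC addKr.
- by apply: adjacent_linked; exists P => //; exists u; rewrite ey addrC addKr.
(* The opposite corner is reached in two edges through [m]. *)
- have [m em] : exists m : vertex Lam, val m = val x + u.
    by apply: (corner_vertex P) => //; exists v, (- u).
  apply: (@linked_trans _ m).
    by apply: adjacent_linked; exists P => //; exists v; rewrite em addrC addKr.
  apply: adjacent_linked; exists P => //; exists (- u).
  by rewrite ey em [_ + v]addrC addrK.
Qed.

Lemma faces_share_corner P Q (c : C) : faces Lam P -> faces Lam Q -> P c -> Q c ->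
  exists2 b : vertex Lam, corner P (val b) & corner Q (val b).
Proof.
move=> FP FQ Pc Qc; have FL := facesP Lam.
have [PQ|PQ] := pselect (P = Q); last first.
  case: (tess_edge_to_edge FL FP FQ PQ) => [e|[a [Pa Qa _]]|].
  - by have : (P `&` Q) c by []; rewrite e.
  - by have [x ex] := corner_vertex P a FP Pa; exists x; rewrite ex.
  - move=> [a [b [[v Pv] [w Qw] _]]].
    have cP : corner P a by exists (b - a), v.
    have [x ex] := corner_vertex P a FP cP; exists x; rewrite ex //.
    by exists (b - a), w.
have [a [u [v Puv]]] := tess_rhombus FL FP.
have cP : corner P a by exists u, v.
by have [x ex] := corner_vertex P a FP cP; exists x; rewrite -?PQ ex.
Qed.

End Connectivity.

(** * Local finiteness of the tessellation and connectedness of its graph *)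

Section LocalFiniteness.
Context {R : realType} (Lam : rhombicLattice R).
Local Notation C := R[i].
Implicit Types (P Q : set C).

(** A congruence is onto and preserves distances, so it carries a disc inside one face to a disc of
    the same radius inside any other. *)
Lemma faces_inradius : exists2 r : R, 0 < r &
  forall P, faces Lam P -> exists c : C, forall y, `|y - c| < r%:C -> P y.
Proof.
have FL := facesP Lam.
have [P0 FP0 _] := tess_cover FL 0.
have [a [u [v P0uv]]] := tess_rhombus FL FP0.
have [c [r [r0 rP]]] := rhombus_ball _ _ _ _ P0uv.
exists r => // P FP; have [phi [[psi _ psiK] iso eP]] := tess_congruent FL FP0 FP.
exists (phi c) => y; rewrite -(psiK y) iso => /rP H.
by rewrite -eP; exists (psi y).
Qed.

(** Otherwise the disc of radius r/2 about [d] would lie in both faces, while distinct faces meet at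
    most in a segment. *)
Lemma inball_separated P Q (c d : C) (r : R) : 0 < r -> faces Lam P -> faces Lam Q ->
  (forall y, `|y - c| < r%:C -> P y) -> (forall y, `|y - d| < r%:C -> Q y) ->
  `|d - c| < (r / 2)%:C -> P = Q.
Proof.
move=> r0 FP FQ cP dQ dc; apply: contrapT => PQ.
have r20 : 0 < r / 2 by rewrite divr_gt0.
have PQsub y : `|y - d| < (r / 2)%:C -> (P `&` Q) y.
  move=> yd; split; last first.
    by apply: dQ; apply: lt_trans yd _; rewrite ltcR; lra.
  apply: cP; rewrite -(subrK d y) -addrA; apply: le_lt_trans (ler_normD _ _) _.
  by rewrite [r]splitr rmorphD; apply: ltrD.
case: (tess_edge_to_edge (facesP Lam) FP FQ PQ) => [e|[a [_ _ e]]|[a [b [_ _ e]]]].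
- by have := PQsub d; rewrite subrr normr0 ltcR e; apply.
- apply: (segment_no_ball a a d _ r20) => y /PQsub; rewrite e => ->.
  by exists 0; rewrite ?lexx ?ler01 // mul0r addr0.
- by apply: (segment_no_ball a b d _ r20) => y /PQsub; rewrite e.
Qed.

(* Faces approaching [x] without containing it would have centres with a cluster
   point, hence infinitely often be the same face, which is closed. *)
Lemma near_faces (x : C) : exists2 d : R, 0 < d &
  forall P y, faces Lam P -> P y -> `|y - x| < d%:C -> P x.
Proof.
apply: contrapT => Nx.
have [r r0 rP] := faces_inradius.
have bad n : exists q : set C * C * C, [/\ faces Lam q.1.1, q.1.1 q.1.2,
    ~ q.1.1 x, `|q.1.2 - x| < (n.+1%:R^-1)%:C
  & forall y, `|y - q.2| < r%:C -> q.1.1 y].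
  apply: contrapT => Nn; apply: Nx; exists n.+1%:R^-1 => [|P y FP Py yx].
    by rewrite invr_gt0.
  apply: contrapT => Px; apply: Nn; have [c cP] := rP _ FP.
  by exists (P, y, c).
have {bad}[q qP] := choice bad.
pose c n := (q n).2.
have cx n : `|c n - x| <= 3%:R%:C.
  have [FP Py Px yx cP] := qP n.
  have [a [u [v Puv]]] := tess_rhombus (facesP Lam) FP.
  have Pc : (q n).1.1 (c n) by apply: cP; rewrite subrr normr0 ltcR.
  rewrite -(subrK (q n).1.2 (c n)) -addrA; apply: le_trans (ler_normD _ _) _.
  have -> : 3%:R%:C = 2 + 1 :> C by rewrite rmorph_nat -natr1.
  apply: lerD.
    exact: (rhombus_diameter _ _ _ _ _ _ Puv Pc Py).
  apply: le_trans (ltW yx) _; rewrite (_ : 1 = 1%:C) // lecR.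
  by rewrite invf_le1 // ler1n.
pose K : set (R * R) := `[Re x - 3, Re x + 3] `*` `[Im x - 3, Im x + 3].
have Kc : compact K by apply: compact_setX; exact: segment_compact.
pose f n : R * R := (Re (c n), Im (c n)).
have fK n : K (f n).
  have hr := le_trans (normc_ge_Re _) (cx n).
  have hi := le_trans (normc_ge_Im _) (cx n).
  move: hr hi; rewrite !lecR /K /f; case: (c n) (x) => [c1 c2] [x1 x2] /=.
  rewrite !ler_norml => h1 h2; split; rewrite /= in_itv /=; lra.
have [p [_ clp]] := Kc (f @ \oo) _ (filterE _ fK).
(* Two centres this close to [p] differ by less than r/4 in each coordinate, hence by less than r/2,
   as [inball_separated] requires. *)
have close m : exists2 n, (m <= n)%N &
    `|Re (c n) - p.1| < r / 8 /\ `|Im (c n) - p.2| < r / 8.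
  have := clp [set f n | n in [set n | (m <= n)%N]]
    (ball p.1 (r / 8) `*` ball p.2 (r / 8)).
  case.
  - by exists m => // n /= mn; exists n.
  - exists (ball p.1 (r / 8), ball p.2 (r / 8)) => //=.
    by split; apply: nbhsx_ballx; rewrite divr_gt0.
  - move=> _ [[n /= mn <-] [/= h1 h2]]; exists n => //.
    by rewrite ![`|_ - p.1|]distrC ![`|_ - p.2|]distrC.
(* The face with index [n0] stays at distance at least [d] from [x], yet it recurs at an index [n]
   so large that it has a point closer than [d]. *)
have [n0 _ [h1 h2]] := close 0%N.
have [FP Py Px yx cP] := qP n0.
have [a [u [v Puv]]] := tess_rhombus (facesP Lam) FP.
have [d d0 dP] := rhombus_separated _ _ _ _ _ Puv Px.
have [m md] : exists m : nat, m.+1%:R^-1 < d.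
  by have [m _ /(_ m (leqnn _)) md] := near_infty_natSinv_lt (PosNum d0); exists m.
have [n mn [h3 h4]] := close m.
have [FP' Py' Px' yx' cP'] := qP n.
have e : (q n0).1.1 = (q n).1.1.
  apply: (inball_separated _ _ (c n0) (c n) r r0 FP FP' cP cP').
  rewrite normc_lt_sqr; last by lra.
  move: h1 h2 h3 h4; rewrite -!/(c _); case: (c n) (c n0) => [c1 c2] [c3 c4] /=.
  rewrite !ltr_norml => h1 h2 h3 h4.
  have k1 : `|c1 - c3| < r / 4 by rewrite ltr_norml; lra.
  have k2 : `|c2 - c4| < r / 4 by rewrite ltr_norml; lra.
  have s1 : (c1 - c3) ^+ 2 < (r / 4) ^+ 2.
    by rewrite -real_normK ?num_real // ltr_sqr ?nnegrE //; lra.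
  have s2 : (c2 - c4) ^+ 2 < (r / 4) ^+ 2.
    by rewrite -real_normK ?num_real // ltr_sqr ?nnegrE //; lra.
  nra.
apply: (dP (q n).1.2); first by rewrite e.
apply: lt_le_trans yx' _; rewrite lecR; apply: le_trans (ltW md).
by rewrite lef_pV2 ?posrE // ler_nat.
Qed.

(** Extends being linked to [o] from vertices to all points of the plane, so that connectedness of a
    real interval can be used. *)
Definition face_linked_to (o : vertex Lam) (z : C) : Prop :=
  exists P (b : vertex Lam),
    [/\ faces Lam P, P z, corner P (val b) & linked Lam o b].

(** A face covering a point [y] near [z] also contains [z], so the property passes between [y] and
    [z] through corners shared with this face. *)
Lemma face_linked_to_near (o : vertex Lam) (z : C) : exists2 d : R, 0 < d &
  forall y, `|y - z| < d%:C -> face_linked_to o y <-> face_linked_to o z.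
Proof.
have [d d0 dP] := near_faces z; exists d => // y yz.
have [Q FQ Qy] := tess_cover (facesP Lam) y.
have Qz := dP _ _ FQ Qy yz.
suff H w w' : Q w -> Q w' -> face_linked_to o w -> face_linked_to o w'.
  by split; apply: H.
move=> Qw Qw' [P [b [FP Pw Pb ob]]].
have [m Pm Qm] := faces_share_corner _ _ _ _ FP FQ Pw Qw.
exists Q, m; split=> //; exact: linked_trans ob (face_linked _ _ _ _ FP Pb Pm).
Qed.

Lemma lattice_connected (o z : vertex Lam) : linked Lam o z.
Proof.
have [P FP Pz] := set_valP z.
suff [Q [b [FQ Qz Qb ob]]] : face_linked_to o (val z).
  have [m Qm Pm] := faces_share_corner _ _ _ _ FQ FP Qz (corner_mem _ _ Pz).
  apply: linked_trans ob _; apply: linked_trans (face_linked _ _ _ _ FQ Qb Qm) _.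
  exact: face_linked FP Pm Pz.
have Fo : face_linked_to o (val o).
  have [P' FP' P'o] := set_valP o; exists P', o; split=> //; first exact: corner_mem.
  by exists [::].
apply: contrapT => Nz.
pose g (t : R) : C := val o + t%:C * (val z - val o).
(* If [z] were not linked to [o], this indicator along the segment from [o] to [z] would be
   continuous with end values 1 and 0, but never 1/2. *)
pose h (t : R) : R := (`[< face_linked_to o (g t) >])%:R.
have hcont : continuous h.
  move=> t; have [d d0 dP] := face_linked_to_near o (g t).
  pose k := Num.sqrt (Re (val z - val o) ^+ 2 + Im (val z - val o) ^+ 2).
  have k0 : 0 < k + 1 by rewrite ltr_wpDl ?sqrtr_ge0.
  (* [k] is the speed |z - o| of [g]; adding 1 keeps the divisor positive. *)
  apply: cvg_near_cst; apply/nbhs_ballP; exists (d / (k + 1)) => /=.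
    exact: divr_gt0.
  move=> s /=; rewrite /ball /= distrC ltr_pdivlMr // => st.
  congr (_%:R); congr (nat_of_bool _); apply: asbool_equiv_eq; apply: dP.
  have -> : g s - g t = (s - t)%:C * (val z - val o) by rewrite /g rmorphB /=; ring.
  rewrite normrM [`|val z - val o|]normc_def -/k.
  rewrite [`|(s - t)%:C|]normc_def /= expr0n addr0 sqrtr_sqr -rmorphM ltcR.
  by apply: le_lt_trans st; rewrite ler_wpM2l // lerDl.
have [] := @IVT R h 0 1 (2^-1) ler01.
- exact: continuous_subspaceT.
- rewrite /h /g mul0r addr0 mul1r addrC subrK asboolT // asboolF //=.
  by rewrite ge_min le_max; apply/andP; split; apply/orP; [right|left]; lra.
- move=> t _; rewrite /h; case: asboolP => _ /= e; lra.
Qed.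

End LocalFiniteness.

(** * Path integrals and shifts *)

Section PathIntegrals.
Context {R : realType} (Lam : rhombicLattice R).
Local Notation C := R[i].
Implicit Types (a b o z w : vertex Lam) (p q : seq (vertex Lam)).

Lemma linear_bundled (V W : lmodType C) (L : V -> W) :
  linear L -> exists L' : {linear V -> W}, L' = L :> (V -> W).
Proof.
move=> linL.
by exists (HB.pack_for (@GRing.Linear.type C V W *:%R) L
             (GRing.isLinear.Build _ _ _ _ L linL)).
Qed.

Lemma path_integral_cat (V : lmodType C) (f : vertex Lam -> V) a p q :
  path_integral f a (p ++ q) = path_integral f a p + path_integral f (last a p) q.
Proof.
by elim: p a => [|b p IH] a /=; rewrite ?add0r // IH addrA.
Qed.

Lemma path_integral_linear (V W : lmodType C) (L : V -> W) (f : vertex Lam -> V)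
    a p :
  linear L -> L (path_integral f a p) = path_integral (L \o f) a p.
Proof.
move=> /linear_bundled[{}L <-].
elim: p a => [|b p IH] a /=; first exact: linear0.
by rewrite linearD 2!(linearZ_LR L) linearD IH.
Qed.

Lemma Zplus_linear (V W : lmodType C) (L : V -> W) (f : vertex Lam -> V) o z :
  linear L -> L (Zplus o f z) = Zplus o (L \o f) z.
Proof.
move=> linL; rewrite /Zplus /Defs.integral -(path_integral_linear V W L) //.
have [L' <-] := linear_bundled _ _ _ linL.
by rewrite linearD (linearZ_LR L') linearB.
Qed.

Lemma discrete_analytic_linear (V W : lmodType C) (L : V -> W)
    (f : vertex Lam -> V) :
  linear L -> discrete_analytic f -> discrete_analytic (L \o f).
Proof.
move=> linL fDA a p /fDA f0; rewrite -(path_integral_linear V W L) // f0.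
by have [L' <-] := linear_bundled _ _ _ linL; rewrite linear0.
Qed.

Section Vector.
Variable V : lmodType C.
Implicit Types f g : vertex Lam -> V.

(** Closing any path from [a] to [b] by one fixed return path [r] shows that its integral is minus
    the integral along [r]. The path [p] witnesses that [xget] picks a genuine path. *)
Lemma integralE f a b p : discrete_analytic f -> lpath a b p ->
  Defs.integral f a b = path_integral f a p.
Proof.
move=> fDA ap; rewrite /Defs.integral; set q := xget _ _.
have aq : lpath a b q by apply: (@xgetPex _ [::] [set p | lpath a b p]); exists p.
have [r [br ra]] := lattice_connected Lam b a.
have closed s : lpath a b s -> path_integral f a s = - path_integral f b r.
  move=> [as_ sb]; apply/eqP; rewrite -addr_eq0 -sb -path_integral_cat.
  by apply/eqP/fDA; rewrite /lpath cat_path last_cat sb as_.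
by rewrite !closed.
Qed.

Lemma integral_increment f o z w : discrete_analytic f -> Defs.adjacent z w ->
  Defs.integral f o w =
    Defs.integral f o z + (val w - val z) *: (2^-1 *: (f z + f w)).
Proof.
move=> fDA zw; have [p [op pz]] := lattice_connected Lam o z.
rewrite (integralE _ _ _ p fDA (conj op pz)) (integralE _ _ _ (p ++ [:: w])) //.
  by rewrite path_integral_cat pz /= addr0.
by split; rewrite ?last_cat // cat_path op pz /= zw.
Qed.

Lemma Zplus_origin f o : discrete_analytic f -> Zplus o f o = 0.
Proof.
by move=> fDA; rewrite /Zplus (integralE _ _ _ [::]) //= subrr scaler0 addr0.
Qed.

(** Along one edge the integral in Z_+ changes by a single trapezoid term; doubling clears the
    halves and leaves a relation without integrals. *)
Lemma Zminus_step f g o z w : is_Zminus o f g -> Defs.adjacent z w ->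
  2 *: f w + (1 - (val w - val z)) *: g w = 2 *: f z + (1 + (val w - val z)) *: g z.
Proof.
move=> [gDA gf] zw.
have fE x : f x = Zplus o g x + f o by rewrite gf subrK.
rewrite (fE w) (fE z) /Zplus (integral_increment g o z w gDA zw).
move: (val w - val z) (Defs.integral g o z) => e I.
have half (v : V) : 2 *: (2^-1 *: v) = v.
  by rewrite scalerA divff ?scale1r ?pnatr_eq0.
have halfe (v : V) : 2 *: (e *: (2^-1 *: v)) = e *: v.
  by rewrite !scalerA mulrAC divff ?mul1r ?pnatr_eq0.
rewrite !scalerDr !half !halfe scalerBl scalerDl !scale1r.
(* The regrouping pairs [g w] and [e *: g w] with their negatives. *)
rewrite [LHS](AC (2*(1*2)*1*2) (1*3*6*4*(7*2)*(5*8))). rewrite /= !subrr !addr0.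
by rewrite [RHS](AC (2*1*1*2) (1*3*4*6*(5*2))) /= subrr addr0.
Qed.
End Vector.

End PathIntegrals.

(** * Operators and point evaluations *)

Section BoundedOperators.
Context {R : realType}.
Local Notation C := R[i].
Implicit Types M N P : normedModType C.

Lemma bounded_operator_id M : bounded_operator (id : M -> M).
Proof. by split=> //; exists 1 => x; rewrite mul1r. Qed.

Lemma bounded_operator_comp M N P (T : N -> P) (S : M -> N) :
  bounded_operator T -> bounded_operator S -> bounded_operator (T \o S).
Proof.
move=> [linT [k kT]] [linS [l lS]]; split=> [a u v|]; first by rewrite /= linS linT.
(* The bound [k] is any complex number, but k |S x| dominates a norm and is therefore equal to |k|
   |S x|. *)
exists (`|k| * l) => x; rewrite -mulrA; apply: (@le_trans _ _ (`|k| * `|S x|)).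
  rewrite -[`|S x|]normr_id -normrM ger0_norm ?normr_id //=.
  exact: le_trans (kT _).
exact: ler_wpM2l.
Qed.

Lemma bounded_operator_scaleD M N (a b : C) (T S : M -> N) :
  bounded_operator T -> bounded_operator S ->
  bounded_operator (fun x => a *: T x + b *: S x).
Proof.
move=> [linT [k kT]] [linS [l lS]]; split=> [c u v|].
  rewrite linT linS !scalerDr !scalerA ![_ * c]mulrC -!scalerA addrACA.
  by rewrite -scalerDr.
exists (`|a| * k + `|b| * l) => x; apply: le_trans (ler_normD _ _) _.
by rewrite !normrZ mulrDl -!mulrA lerD // ler_wpM2l.
Qed.

(** For nonzero [c], 2 + cA equals -c (t - A) with t = -2/c outside the spectrum; for c = 0 it is
    just multiplication by 2. *)
Lemma resolvent_shift_invertible M (A : M -> M) (c : C) :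
  bounded_operator A ->
  (forall t, 2 + t * c = 0 -> ~ spectrum A t) ->
  exists B : M -> M, [/\ bounded_operator B,
    (forall x, B (2 *: x + c *: A x) = x) & forall x, 2 *: B x + c *: A (B x) = x].
Proof.
move=> bA; have [-> _|c0 Ac] := eqVneq c 0.
  exists (fun x => 2^-1 *: x + 0 *: x); split=> [|x|x].
  - by apply: bounded_operator_scaleD; exact: bounded_operator_id.
  - by rewrite !scale0r !addr0 scalerA mulVf ?scale1r ?pnatr_eq0.
  - by rewrite !scale0r !addr0 scalerA mulfV ?scale1r ?pnatr_eq0.
pose t := - 2 / c.
have tc : 2 + t * c = 0 by rewrite divfK // subrr.
have /contrapT [B [bB BAl BAr]] := Ac t tc.
have AE x : 2 *: x + c *: A x = - c *: (t *: x - A x).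
  have ct : - c * t = 2 by rewrite /t; field.
  by rewrite scalerBr scalerA ct scaleNr opprK.
have linA := bA.1; have linB := bB.1.
have [A' eA] := linear_bundled _ _ _ linA; have [B' eB] := linear_bundled _ _ _ linB.
have Nc0 : - c != 0 by rewrite oppr_eq0.
(* The zero summand gives the map the shape of [bounded_operator_scaleD]. *)
exists (fun x => (- c)^-1 *: B x + 0 *: B x); split=> [|x|x].
- exact: bounded_operator_scaleD.
- rewrite scale0r addr0 AE -eB (linearZ_LR B') scalerA mulVf // scale1r eB.
  exact: (congr1 (fun h => h x) BAl).
- rewrite scale0r addr0 AE -eA (linearZ_LR A') eA scalerA mulrC -scalerA -scalerBr.
  rewrite scalerA mulfV // scale1r.
  exact: (congr1 (fun h => h x) BAr).
Qed.
End BoundedOperators.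

(** * Point evaluations and the symbolic resolvent *)

Section PointEvaluation.
Context {R : realType} (Lam : rhombicLattice R) (o : vertex Lam).
Local Notation C := R[i].
Context {M N : completeNormedModType C} (ev : M -> vertex Lam -> N) (A : M -> M).
Hypothesis evP : rkhs_of_da_functions ev.
Hypothesis bndA : bounded_operator A.
Hypothesis A_Zminus : forall f, is_Zminus o (ev f) (ev (A f)).
Hypothesis specA : singular_set Lam `&` spectrum A = set0.
Implicit Types z w : vertex Lam.

Lemma ev_linear z : linear (fun f => ev f z).
Proof. by have [_ _ _ /(_ z)[]] := evP. Qed.

Definition commutant (T : M -> M) : Prop := linear T /\ forall x, T (A x) = A (T x).

(** This invariant passes to products and inverses, and makes operators built along unrelated paths
    commute with each other. *)
Definition bicommutant (T : M -> M) : Prop :=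
  forall S, commutant S -> forall x, S (T x) = T (S x).

Lemma edge_inverse z w : Defs.adjacent z w -> exists B : M -> M,
  [/\ bounded_operator B,
      forall x, B (2 *: x + (1 - (val w - val z)) *: A x) = x
    & forall x, 2 *: B x + (1 - (val w - val z)) *: A (B x) = x].
Proof.
move=> /asboolP zw; apply: resolvent_shift_invertible => // t tS sp.
suff : (singular_set Lam `&` spectrum A) t by rewrite specA.
split=> //; exists (val w - val z) => //.
by exists (val z), (val w).
Qed.

Lemma evaluation_operator z : exists T : M -> M,
  [/\ bounded_operator T, bicommutant T & forall x, ev (T x) o = ev x z].
Proof.
have [p [op <-]] := lattice_connected Lam o z.
elim/last_ind: p op => [_|p w IH] /=.
  by exists id; split=> //; exact: bounded_operator_id.
rewrite rcons_path last_rcons; set y := last o p => /andP[/IH[T [bT cT evT]] yw].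
have [B [bB Bl Br]] := edge_inverse _ _ yw.
pose e := val w - val y.
have linT := bT.1; have [T' eT] := linear_bundled _ _ _ linT.
(* One more factor (2 + (1 + e) A) (2 + (1 - e) A)^-1 of the product formula for the resolvent. *)
exists (T \o (fun x => 2 *: B x + (1 + e) *: (A \o B) x)); split.
- apply: bounded_operator_comp => //; apply: bounded_operator_scaleD => //.
  exact: bounded_operator_comp.
- move=> S cS x /=; rewrite (cT S cS); congr (T _).
  case: cS => linS SA; have [S' eS] := linear_bundled _ _ _ linS.
  (* [S] commutes with 2 + (1 - e) A, hence with its inverse [B]. *)
  have SB u : S (B u) = B (S u).
    rewrite -[LHS]Bl -SA -{3}(Br u); congr (B _).
    by rewrite -eS (linearD S') !(linearZ_LR S').
  by rewrite -!SB -!SA -eS (linearD S') !(linearZ_LR S').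
- move=> x /=; rewrite evT.
  have [Ey eEy] := linear_bundled _ _ _ (ev_linear y).
  have [Ew eEw] := linear_bundled _ _ _ (ev_linear w).
  have step := Zminus_step Lam N _ _ _ _ _ (A_Zminus (B x)) yw.
  transitivity (2 *: ev (B x) y + (1 + e) *: ev (A (B x)) y).
    by rewrite -!/((fun f => ev f y) _) -eEy (linearD Ey) !(linearZ_LR Ey).
  rewrite -step -[x in RHS]Br.
  by rewrite -!/((fun f => ev f w) _) -eEw (linearD Ew) !(linearZ_LR Ew) eEw.
Qed.

Lemma commutant_bicommutant T : bounded_operator T -> bicommutant T -> commutant T.
Proof.
by move=> [linT _] cT; split=> // x; rewrite cT //; split=> //; case: bndA.
Qed.

(** By injectivity of [ev] it suffices to compare values at each [z], and commutation turns the
    value of [S x] at [z] into that of [S (G z x)] at [o]. *)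
Lemma evaluation_operators_separate (G : vertex Lam -> M -> M) (S T : M -> M) :
  (forall z x, ev (G z x) o = ev x z) ->
  (forall z x, G z (S x) = S (G z x)) -> (forall z x, G z (T x) = T (G z x)) ->
  (forall x, ev (S x) o = ev (T x) o) -> S = T.
Proof.
move=> evG GS GT evST; have [_ evI _ _] := evP.
apply/funext => x; apply: evI; apply/funext => z.
by rewrite -(evG z (S x)) -(evG z (T x)) GS GT evST.
Qed.

Lemma symbolic_resolvent_exists : exists G, is_symbolic_resolvent o A G.
Proof.
have [G GP] := choice evaluation_operator.
have bG z : bounded_operator (G z) by case: (GP z).
have cG z : bicommutant (G z) by case: (GP z).
have evG z x : ev (G z x) o = ev x z by case: (GP z).
have GA z x : G z (A x) = A (G z x) by case: (commutant_bicommutant _ (bG z) (cG z)).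
have GG z w x : G z (G w x) = G w (G z x).
  exact: (cG w _ (commutant_bicommutant _ (bG z) (cG z))).
have [_ _ evDA _] := evP.
have at_linear x : linear (fun T : M -> M => T x) by [].
have IE a p x : path_integral G a p x = path_integral (fun z => G z x) a p.
  exact: (path_integral_linear Lam (M -> M) M (fun T => T x)).
have ZE z x : Zplus o G z x = Zplus o (fun z => G z x) z.
  exact: (Zplus_linear Lam (M -> M) M (fun T => T x)).
have IS (S : M -> M) a p x : linear S -> (forall z x, S (G z x) = G z (S x)) ->
    S (path_integral G a p x) = path_integral G a p (S x).
  move=> linS SG; rewrite !IE (path_integral_linear Lam M M S) //.
  by congr path_integral; apply/funext => z /=.
have ZS (S : M -> M) z x : linear S -> (forall z x, S (G z x) = G z (S x)) ->
    S (Zplus o G z x) = Zplus o G z (S x).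
  move=> linS SG; rewrite !ZE (Zplus_linear Lam M M S) //.
  by congr Zplus; apply/funext => y /=.
(* After evaluation at [o] the identity reads f - Z_+ (A f) = f(0) for the function f of [x]. *)
have third z : G z - (Zplus o G z \o A) = id.
  apply: (evaluation_operators_separate G) => // [w x|x].
    have [Gw eGw] := linear_bundled _ _ _ (bG w).1.
    rewrite -[LHS]/(G w (G z x - Zplus o G z (A x))) -{1}eGw (linearB Gw) eGw.
    by rewrite GG (ZS (G w)) ?GA //; exact: (bG w).1.
  have [E eE] := linear_bundled _ _ _ (ev_linear o).
  rewrite -[LHS]/((fun f => ev f o) (G z x - Zplus o G z (A x))) -eE (linearB E) eE.
  rewrite evG ZE (Zplus_linear Lam M N _ _ _ _ (ev_linear o)).
  have -> : (fun f => ev f o) \o (fun z => G z (A x)) = ev (A x).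
    by apply/funext => y; rewrite /= evG.
  by case: (A_Zminus x) => _ ->; rewrite opprB addrC subrK.
exists G; split=> // [a p ap|z].
- apply: (evaluation_operators_separate G) => // [w x|w x|x].
  + by rewrite (IS (G w)) //; exact: (bG w).1.
  + by have [Gw <-] := linear_bundled _ _ _ (bG w).1; rewrite linear0.
  + rewrite IE (path_integral_linear Lam M N _ _ _ _ (ev_linear o)).
    have -> : (fun f => ev f o) \o (fun z => G z x) = ev x.
      by apply/funext => y; rewrite /= evG.
    rewrite evDA //; have [E eE] := linear_bundled _ _ _ (ev_linear o).
    by rewrite -[RHS]/((fun f => ev f o) 0) -eE linear0.
(* [A] commutes with every [G z], hence passes through Z_+. *)
- rewrite -[RHS](third z); congr (_ - _); apply/funext => x /=.
  by apply: ZS => //; case: bndA.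
Qed.

Lemma symbolic_resolvent_evaluation G z x : is_symbolic_resolvent o A G ->
  ev (G z x) o = ev x z.
Proof.
move=> [bG GDA GZ _].
have Go : G o = id.
  by rewrite -(GZ o) Zplus_origin //; apply/funext => y; rewrite /= subr0.
(* The resolvent equation says that Z_- takes z -> G(z) y to z -> G(z) A y, so the edge recursion
   applies to these [M]-valued functions. *)
have GZminus y : is_Zminus o (fun z => G z y) (fun z => G z (A y)).
  have at_linear : linear (fun T : M -> M => T (A y)) by [].
  split=> [|w].
    exact: (discrete_analytic_linear Lam (M -> M) M _ _ at_linear GDA).
  rewrite -[LHS](Zplus_linear Lam (M -> M) M _ _ _ _ at_linear) Go.
  have := congr1 (fun T => T y) (GZ w).
  rewrite -[LHS]/(G w y - Zplus o G w (A y)) -[RHS]/y => e.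
  by apply/eqP; rewrite eq_sym subr_eq addrC -subr_eq; apply/eqP.
have [p [op <-]] := lattice_connected Lam o z.
elim/last_ind: p x op => [x _|p w IH x] /=; first by rewrite Go.
rewrite rcons_path last_rcons; set y := last o p => /andP[/IH{}IH yw].
(* With x = (2 + (1 - e) A) B x, the recursion for [G] leads from [w] to [y], where the induction
   hypothesis applies; the recursion for [ev] leads back to [w]. *)
have [B [_ _ Br]] := edge_inverse _ _ yw; rewrite -(Br x).
have linG u : linear (G u) by case: (bG u).
have [Gy eGy] := linear_bundled _ _ _ (linG y).
have [Gw eGw] := linear_bundled _ _ _ (linG w).
have [Ey eEy] := linear_bundled _ _ _ (ev_linear y).
have [Ew eEw] := linear_bundled _ _ _ (ev_linear w).
rewrite -eGw (linearD Gw) !(linearZ_LR Gw) eGw.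
rewrite (Zminus_step Lam M _ _ _ _ _ (GZminus (B x)) yw).
rewrite -eGy -!(linearZ_LR Gy) -(linearD Gy) eGy IH.
rewrite -/((fun f => ev f y) _) -eEy (linearD Ey) !(linearZ_LR Ey) eEy.
rewrite -(Zminus_step Lam N _ _ _ _ _ (A_Zminus (B x)) yw).
by rewrite -[RHS]/((fun f => ev f w) _) -eEw (linearD Ew) !(linearZ_LR Ew) eEw.
Qed.

Lemma symbolic_resolventP : is_symbolic_resolvent o A (symbolic_resolvent o A).
Proof. exact: (@xgetPex _ _ _ symbolic_resolvent_exists). Qed.
End PointEvaluation.

(** * The point evaluation formula and the factorized kernel *)

Lemma dot_separated (R : realType) (M : completeNormedModType R[i])
    (ip : {dot M for @Num.conj R[i]}) (x y : M) :
  hilbert_product ip -> (forall f, ip f x = ip f y) -> x = y.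
Proof.
move=> hilb H; apply/eqP; rewrite -subr_eq0 -normr_eq0 -sqrf_eq0 -hilb.
by rewrite linearBr /= H subrr.
Qed.

Theorem theorem3p3 (R : realType) (Lam : rhombicLattice R)
    (o : vertex Lam) (o0 : val o = 0)
    (dir1 : directions Lam 1)
    (coh : coherent_tracks_on_both_sides Lam)
    (N : completeNormedModType R[i]) (ipN : {dot N for @Num.conj R[i]})
    (hilbN : hilbert_product ipN)
    (M : completeNormedModType R[i]) (ipM : {dot M for @Num.conj R[i]})
    (hilbM : hilbert_product ipM)
    (ev : M -> vertex Lam -> N) (rkhsM : rkhs_of_da_functions ev)
    (A : M -> M) (bndA : bounded_operator A)
    (A_Zminus : forall f, is_Zminus o (ev f) (ev (A f)))
    (specA : singular_set Lam `&` spectrum A = set0) :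
  let C := fun f : M => ev f o in
  let F := fun z : vertex Lam => C \o symbolic_resolvent o A z in
  [/\ bounded_operator C,
      forall (f : M) (z : vertex Lam), C (symbolic_resolvent o A z f) = ev f z
    & forall K, reproducing_kernel ipM ipN ev K ->
      forall z w, K z w = F z \o adjoint ipM ipN (F w)].
Proof.
move=> C F.
have Fev z f : F z f = ev f z.
  apply: (symbolic_resolvent_evaluation _ _ _ A rkhsM bndA A_Zminus specA).
  exact: (symbolic_resolventP _ _ _ _ rkhsM bndA A_Zminus specA).
split=> [|f z|K [_ KP] z w]; [by have [_ _ _] := rkhsM; apply|exact: Fev|].
apply/funext => x; have [k kK kip] := KP w x.
(* Kernel elements are the vectors representing the functionals f -> <f(w), y>, so an adjoint exists
   and [xget] does not return its default. *)
have adjP : forall f y, ipN (F w f) y = ipM f (adjoint ipM ipN (F w) y).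
  have riesz y : exists s : M, forall f, ipM f s = ipN (ev f w) y.
    by have [s _ sP] := KP w y; exists s.
  have [S SP] := choice riesz.
  apply: (@xgetPex _ _ [set S | forall f y, ipN (F w f) y = ipM f (S y)]).
  by exists S => f y; rewrite Fev SP.
(* The value K(z, w) x is F(z) k, so it remains to identify [k] with F(w)^* x by pairing both with
   every [f]. *)
rewrite -kK -Fev /=; congr (F z _).
by apply: (dot_separated _ _ _ _ _ hilbM) => f; rewrite -adjP Fev kip.
Qed.
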